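(* Let $r\in\mathbb{Q}$ and let $n\geq 1$ be an integer. Suppose that $\tan^n(r\pi)$ is (defined and) rational. Then \[\tan(r\pi)\in\left\{0,\ \pm 1,\ \pm\sqrt{3},\ \pm\frac{1}{\sqrt{3}}\right\}.\]
   Context: Here $\tan^n(r\pi)$ denotes the $n$-th power $(\tan(r\pi))^n$, and $\tan(r\pi)$ is defined exactly when $\cos(r\pi)\neq 0$. *)

(* Defs.v *)
(* [tan x := sin x / cos x] is total in MathComp-Analysis (it is 0 where
   [cos x = 0]), so "tan x is defined" has to be stated as [cos x != 0]. *)
From mathcomp Require Export all_boot all_order all_algebra.
From mathcomp Require Export boolp classical_sets reals trigo.

(* Main.v *)
(** Put [t = r pi] and [x = exp (2 i t)], a root of unity with
    [x - 1 = i tan t (x + 1)]. If [tan t ^ n] is rational, then [x] is a root of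
    the rational polynomial [(X - 1)^m - c (X + 1)^m] with [m = 4 n], hence so are
    all its Galois conjugates. This equation fixes [|y - 1| / |y + 1|], so on the
    unit circle it fixes [y] up to inversion: [x] has degree at most 2 over the
    rationals. The minimal polynomial of [x] being integral, [2 cos (2 t)] is an
    integer, and [tan t ^ 2 = (2 - 2 cos (2 t)) / (2 + 2 cos (2 t))] leaves only
    the values 0, 1/3, 1 and 3. *)
Require Import Defs.
From mathcomp Require Import all_boot all_order all_algebra all_field.
From mathcomp Require Import boolp classical_sets reals trigo.
From mathcomp Require Import complex zify ring lra.
Import Order.TTheory GRing.Theory Num.Theory.
Local Open Scope ring_scope.

Lemma root_Cyclotomic_unity {C : numFieldType} {b : nat} {x : C} :
  (0 < b)%N -> x ^+ b = 1 ->
  exists2 d, (0 < d)%N & root (map_poly intr 'Phi_d) x.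
Proof.
move=> b_gt0 xb1.
have : root (map_poly intr ('X^b - 1 : {poly int})) x.
  by rewrite rmorphB rmorph1 /= map_polyXn /root !hornerE xb1 subrr.
rewrite -(prod_Cyclotomic b_gt0) rmorph_prod rootE horner_prod.
rewrite prodf_seq_eq0 => /hasP[d].
by rewrite -dvdn_divisors // => /(dvdn_gt0 b_gt0) ? /andP[_ ?]; exists d.
Qed.

(* Irreducibility of ['Phi_d] over the rationals, phrased across two fields:
   a common root with [p] in [C] makes ['Phi_d] divide [p]. *)
Lemma root_prim_root_of_Cyclotomic {C : numFieldType} {x : C} {d : nat}
    {p : {poly rat}} {z : algC} :
  root (map_poly intr 'Phi_d) x -> root (map_poly ratr p) x ->
  d.-primitive_root z -> root (map_poly ratr p) z.
Proof.
move=> Phi_x p_x z_prim.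
have [q [Dq q_monic] q_dvd] := minCpolyP z.
have qE : q = map_poly intr 'Phi_d.
  apply: (map_poly_inj (ratr : {rmorphism rat -> algC})).
  rewrite -Dq (minCpoly_cyclotomic z_prim) -(Cintr_Cyclotomic z_prim).
  by rewrite -map_poly_comp; apply: eq_map_poly => a /=; rewrite ratr_int.
have q_x : root (map_poly ratr q) x.
  rewrite qE -map_poly_comp.
  by rewrite (eq_map_poly (g := intr)) // => a /=; rewrite ratr_int.
have q_neq0 : q != 0 by rewrite monic_neq0.
have g_neq0 : gcdp p q != 0 by rewrite gcdp_eq0 negb_and q_neq0 orbT.
have g_size : (1 < size (gcdp p q))%N.
  rewrite -(size_map_poly (ratr : {rmorphism rat -> C})).
  apply: (@root_size_gt1 _ x); first by rewrite map_poly_eq0.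
  by rewrite gcdp_map root_gcd p_x.
have /dvdpP[h Dh] := dvdp_gcdr p q.
have [k Dk] : exists k, p = k * gcdp p q by apply/dvdpP/dvdp_gcdl.
have h_neq0 : h != 0 by apply: contraNneq q_neq0 => h0; rewrite Dh h0 mul0r.
have : root (map_poly ratr q) z by rewrite q_dvd.
rewrite {1}Dh rmorphM rootM => /orP[|g_z]; last first.
  by rewrite Dk rmorphM rootM g_z orbT.
(* Impossible case: [q], minimal for [z], would divide its own cofactor [h], whose degree is smaller
   since [gcdp p q] is nonconstant. *)
move=> h_z; have : q %| h by rewrite -q_dvd.
move/(dvdp_leq h_neq0); rewrite {1}Dh size_mul // -subn1 leqNgt ltn_subRL.
by rewrite addnC ltn_add2l g_size.
Qed.

Lemma norm_prim_root {d : nat} {z : algC} : d.-primitive_root z -> `|z| = 1.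
Proof.
move=> z_prim; apply/eqP.
rewrite -(@pexpr_eq1 _ _ d) ?(prim_order_gt0 z_prim) //.
by rewrite -normrX (prim_expr_order z_prim) normr1.
Qed.

(* Taking absolute values, both equations give [|z-1|/|z+1| = |w-1|/|w+1|],
   which determines the real part on the unit circle. *)
Lemma unit_circle_ratio_inj {m : nat} {c z w : algC} :
  (0 < m)%N -> `|z| = 1 -> `|w| = 1 ->
  (z - 1) ^+ m = c * (z + 1) ^+ m -> (w - 1) ^+ m = c * (w + 1) ^+ m ->
  w = z \/ w = z^-1.
Proof.
move=> m_gt0 z1 w1 Ez Ew.
have zz : z * z^* = 1 by rewrite -normCK z1 expr1n.
have ww : w * w^* = 1 by rewrite -normCK w1 expr1n.
have : `|(z - 1) * (w + 1)| = `|(w - 1) * (z + 1)|.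
  apply/eqP; rewrite -(@eqrXn2 _ m) // -!normrX !exprMn Ez Ew.
  by apply/eqP; congr `|_|; ring.
move/(congr1 (fun t => t ^+ 2)); rewrite !normCK !(rmorphM, rmorphB, rmorphD).
rewrite !rmorph1 => E.
have {}E : (w - z) * (z * w - 1) = 0.
  have : (z * z^* + 1 - z - z^* ) * (w * w^* + 1 + w + w^* )
         - (w * w^* + 1 - w - w^* ) * (z * z^* + 1 + z + z^* ) = 0.
    by apply/eqP; rewrite subr_eq0; apply/eqP; transitivity
      ((z - 1) * (w + 1) * ((z^* - 1) * (w^* + 1))); [ring | rewrite E; ring].
  rewrite zz ww => {}E; apply: (@mulfI _ 4); first by rewrite pnatr_eq0.
  (* On the unit circle [E] reduces to [w + w^* = z + z^*]; multiplying by [z * w] gives the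
     factored form. *)
  transitivity (4 * (w * z * (w - z)
    + z * (w * w^* ) - w * (z * z^* ))); first by rewrite zz ww; ring.
  by rewrite mulr0 -[RHS](mulr0 (z * w)) -[in RHS]E; ring.
have z_neq0 : z != 0.
  by apply: contra_eq_neq zz => ->; rewrite mul0r eq_sym oner_eq0.
move/eqP: E; rewrite mulf_eq0 !subr_eq0 => /orP[/eqP|/eqP zw]; [by left|right].
by rewrite -[LHS](mulKf z_neq0) zw mulr1.
Qed.

(** The equation transfers from [x] to every primitive [d]-th root of unity, and on the unit circle
    its solutions are at most [z] and [z^-1]; hence [totient d <= 2]. *)
Lemma size_Cyclotomic_le3 {C : numFieldType} {x : C} {d m : nat} {q : rat} :
  (0 < d)%N -> (0 < m)%N -> root (map_poly intr 'Phi_d) x ->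
  (x - 1) ^+ m = ratr q * (x + 1) ^+ m -> (size 'Phi_d <= 3)%N.
Proof.
move=> d_gt0 m_gt0 Phi_x Ex.
pose p : {poly rat} := ('X - 1) ^+ m - q%:P * ('X + 1) ^+ m.
have root_p (K : numFieldType) (y : K) :
    reflect ((y - 1) ^+ m = ratr q * (y + 1) ^+ m) (root (map_poly ratr p) y).
  rewrite /p rmorphB rmorphM !rmorphXn rmorphB rmorphD !rmorph1 /= map_polyX map_polyC.
  by rewrite rootE !hornerE subr_eq0; apply: eqP.
have [z z_prim] := C_prim_root_exists d_gt0.
have prim_eq (w : algC) : d.-primitive_root w -> (w - 1) ^+ m = ratr q * (w + 1) ^+ m.
  move=> w_prim; apply/root_p.
  by apply: (root_prim_root_of_Cyclotomic Phi_x _ w_prim); apply/root_p.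
rewrite size_Cyclotomic ltnS.
(* All primitive [d]-th roots, without repetition, so that [totient d] is the size of a list
   contained in [[:: z; z^-1]]. *)
pose s := [seq z ^+ k | k : 'I_d in [pred k : 'I_d | coprime k d]].
have s_uniq : uniq s.
  rewrite map_inj_uniq ?enum_uniq // => i j /eqP.
  by rewrite (eq_prim_root_expr z_prim) !modn_small // => /eqP/val_inj.
have -> : totient d = size s.
  rewrite size_map -cardE totient_count_coprime -big_mkcond big_mkord sum1_card.
  by apply: eq_card => k; rewrite !inE coprime_sym.
apply: (@uniq_leq_size _ s [:: z; z^-1] s_uniq) => w /mapP[k].
rewrite mem_enum inE => k_co ->.
have w_prim : d.-primitive_root (z ^+ k) by rewrite prim_root_exp_coprime.
have Ez := prim_eq _ z_prim; have Ew := prim_eq _ w_prim.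
have [->|->] := unit_circle_ratio_inj m_gt0 (norm_prim_root z_prim)
  (norm_prim_root w_prim) Ez Ew.
  by rewrite mem_head.
by rewrite !inE eqxx orbT.
Qed.

(** The imaginary part of a quadratic equation is [s * (2 * c + p_1) = 0], with [p_1] the linear
    coefficient. If [s = 0], as degree 1 forces, the point is 1 or -1. *)
Lemma monic_int_quadratic_twice_Re {R : realType} {p : {poly int}} {c s : R} :
  p \is monic -> (size p <= 3)%N -> c ^+ 2 + s ^+ 2 = 1 ->
  root (map_poly intr p) (c +i* s)%C -> exists k : int, 2 * c = k%:~R.
Proof.
move=> p_monic p_size cs1.
have p_size_gt0 : (0 < size p)%N by rewrite size_poly_gt0 monic_neq0.
rewrite rootE horner_coef size_map_inj_poly //; last exact: intr_inj.
have intrE (a : int) : a%:~R = (a%:~R +i* 0)%C :> R[i].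
  by rewrite complexr0 rmorph_int.
have c_int : s = 0 -> exists k : int, 2 * c = k%:~R.
  move=> s0; have /eqP : c ^+ 2 = 1 by rewrite -cs1 s0 expr0n addr0.
  by rewrite sqrf_eq1 => /orP[/eqP->|/eqP->]; [exists 2|exists (-2)];
    rewrite ?mulr1 ?mulrN1.
move/monicP: p_monic; rewrite lead_coefE.
case: (size p) p_size_gt0 p_size => [|[|[|[|//]]]] //= _ _ lead1;
  rewrite !big_ord_recl big_ord0 /= !coef_map /= !lead1 !intrE ?mulr1z.
- rewrite expr0 mulr1 addr0 eq_complex /=; by rewrite oner_eq0.
- rewrite expr0 expr1 addr0 eq_complex /= => /andP[_ /eqP E].
  apply: c_int; lra.
- rewrite expr0 expr1 expr2 addr0 eq_complex /= => /andP[_ /eqP E].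
  have /eqP : s * (2 * c + (p`_1)%:~R) = 0 by rewrite -[RHS]E /bump /=; ring.
  rewrite mulf_eq0 => /orP[/eqP/c_int //|]; rewrite addr_eq0 => /eqP->.
  by exists (- p`_1); rewrite rmorphN.
Qed.

Local Open Scope complex_scope.

Lemma cosiD {R : realType} (x y : R) :
  cos (x + y) +i* sin (x + y) = (cos x +i* sin x) * (cos y +i* sin y).
Proof. by rewrite cosD sinD [_ + cos x * sin y]addrC. Qed.

Lemma cosiMn {R : realType} (x : R) (n : nat) :
  cos (x *+ n) +i* sin (x *+ n) = (cos x +i* sin x) ^+ n.
Proof.
elim: n => [|n IHn]; first by rewrite mulr0n cos0 sin0 expr0.
by rewrite mulrS cosiD IHn exprS.
Qed.

Lemma cosi_ratr_pi_unity {R : realType} (r : rat) :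
  exists2 b, (0 < b)%N &
  (cos (ratr r * pi : R) +i* sin (ratr r * pi : R)) ^+ b = 1.
Proof.
(* The denominator turns the angle into [numq r * pi]; the factor 2 makes it a multiple of the full
   turn. *)
exists (`|denq r| * 2)%N; first by rewrite muln_gt0 absz_gt0 denq_neq0.
rewrite -cosiMn mulrnA.
have -> : (ratr r * pi : R) *+ `|denq r|%N = (numq r)%:~R * pi.
  rewrite -mulr_natl natr_absz normr_denq mulrA; congr (_ * _).
  by rewrite -[in ratr r](divq_num_den r) fmorph_div /= !ratr_int mulrC divfK
    // intr_eq0 denq_neq0.
have sq (k : nat) : cos (k%:R * pi *+ 2 : R) +i* sin (k%:R * pi *+ 2 : R) = 1.
  by rewrite -mulrnAr mulr_natl cosiMn cos2pi sin2pi expr1n.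
case: (numq r) => k; first exact: sq.
rewrite NegzE rmorphN /= mulNr mulNrn cosN sinN.
by have [-> ->] := sq k.+1; rewrite oppr0.
Qed.

Theorem theorem4 (R : realType) (r : rat) (n : nat) :
  (1 <= n)%N ->
  cos (ratr r * pi : R) != 0 ->
  rational (tan (ratr r * pi : R) ^+ n) ->
  tan (ratr r * pi : R) \in
    ([:: 0; 1; - 1; Num.sqrt 3; - Num.sqrt 3;
         1 / Num.sqrt 3; - (1 / Num.sqrt 3)] : seq R).
Proof.
move=> n_gt0; have [b b_gt0] := @cosi_ratr_pi_unity R r.
set t := ratr r * pi => tb cos_neq0 [q _ Dq].
pose x := (cos t +i* sin t) ^+ 2 : R[i].
have xb : x ^+ b = 1 by rewrite /x -exprM mulnC exprM tb expr1n.
have [d d_gt0 Phi_x] := root_Cyclotomic_unity b_gt0 xb.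
have tanE : sin t = tan t * cos t by rewrite /tan divfK.
have x_tan : x - 1 = (0 +i* tan t) * (x + 1).
  have -> : 1 = (cos t ^+ 2 + sin t ^+ 2)%:C :> R[i] by rewrite cos2Dsin2.
  apply/eqP; rewrite /x expr2 eq_complex /= tanE.
  by apply/andP; split; apply/eqP; ring.
(* The factor 4 in the exponent removes the imaginary unit, as its fourth power is 1, and leaves a
   rational constant. *)
have x_pow : (x - 1) ^+ (4 * n) = ratr (q ^+ 4) * (x + 1) ^+ (4 * n).
  rewrite x_tan exprMn; congr (_ * _).
  have -> : (0 +i* tan t) ^+ (4 * n) = (tan t ^+ n ^+ 4)%:C.
    rewrite exprM [in RHS]exprAC rmorphXn /=; congr (_ ^+ n).
    rewrite !exprS expr0 mulr1; apply/eqP; rewrite eq_complex /=.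
    by apply/andP; split; apply/eqP; ring.
  by rewrite -Dq rmorphXn !fmorph_rat rmorphXn.
have := size_Cyclotomic_le3 d_gt0 _ Phi_x x_pow.
rewrite muln_gt0 => /(_ n_gt0) Phi_size.
have [k Dk] : exists k : int, 2 * cos (t *+ 2) = k%:~R.
  apply: (monic_int_quadratic_twice_Re (Cyclotomic_monic d) Phi_size
    (cos2Dsin2 _)).
  by rewrite cosiMn.
have k4 : k%:~R + 2 = 4 * cos t ^+ 2 by rewrite -Dk cos_mulr2n; ring.
have k_tan : (k%:~R + 2) * tan t ^+ 2 = 2 - k%:~R.
  rewrite k4 -mulrA -exprMn [cos t * _]mulrC -tanE sin2cos2.
  by rewrite mulrBr -k4; ring.
(* Strict because [cos t != 0]. The values -1, 0, 1, 2 of [k] then give [tan t ^+ 2] equal to 3, 1,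
   1/3, 0. *)
have k_gt : -2 < k.
  by rewrite -(ltr_int R) -subr_gt0 opprK k4 mulr_gt0 // exprn_even_gt0.
have k_le : k <= 2.
  rewrite -(ler_int R) -subr_ge0 -k_tan k4 mulr_ge0 ?sqr_ge0 //.
  by rewrite mulr_ge0 ?sqr_ge0.
have sqrP (y a : R) :
    0 <= a -> y ^+ 2 = a -> y = Num.sqrt a \/ y = - Num.sqrt a.
  move=> a_ge0 ya; have /eqP : y ^+ 2 = Num.sqrt a ^+ 2 by rewrite sqr_sqrtr.
  by rewrite eqf_sqr => /orP[/eqP|/eqP]; [left|right].
rewrite !inE.
have : k \in [:: -1; 0; 1; 2] by rewrite !inE; lia.
rewrite !inE => /or4P[] /eqP k_val; rewrite k_val in k_tan.
- have [||->|->] := sqrP (tan t) 3; rewrite ?eqxx ?orbT //; lra.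
- have [||->|->] := sqrP (tan t) 1; rewrite ?sqrtr1 ?eqxx ?orbT //; lra.
- have [||->|->] := sqrP (tan t) (3^-1);
    rewrite ?sqrtrV // ?div1r ?eqxx ?orbT //; lra.
- have /eqP : tan t ^+ 2 = 0 by lra.
  by rewrite sqrf_eq0 => ->.
Qed.
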